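(* Let $\mathbb{F}$ be a finite field, let $A\in \mathbb{F}^{n\times n}$ be generic and let $U\cdot C\cdot U^{-1}$ be a Frobenius normal form of $A$. Let $R=(r_{i,j})\in\mathbb{F}^{n\times(2n-1)}$ be a matrix such that for every $k\in[n]$, $U\cdot C^k$ equals the submatrix of $R$ consisting of columns $k,k+1,\ldots,n+k-1$, and suppose $U$, $C$, $U^{-1}$ and $R$ are given. Let $S,T\subseteq [n]$ and let $h=\lfloor n^{\alpha}\rfloor$, $|S|=\lfloor n^{s}\rfloor$, $|T|=\lfloor n^t\rfloor$ for some $\alpha,s,t\in [0,1]$. Then the submatrices $(A^1)_{S,T},\ldots,(A^h)_{S,T}$ can be computed using $\widetilde{O}(n^{\omega(s,1-\alpha,t)+\alpha})$ field operations.
   Context: A matrix $A\in\mathbb{F}^{n\times n}$ is called generic if its characteristic polynomial equals its minimal polynomial. For generic $A$ with characteristic polynomial $t^n+c_{n-1}t^{n-1}+\dots+c_0$, a Frobenius normal form is a factorization $A=UCU^{-1}$ with $U$ invertible and $C$ the companion matrix (ones on the subdiagonal, last column $(-c_0,\ldots,-c_{n-1})^T$, zeros elsewhere). $[n]=\{1,\ldots,n\}$; $M_{S,T}$ is the submatrix with rows $S$ and columns $T$. $\omega(a,b,c)$ denotes the exponent such that an $n^a\times n^b$ matrix can be multiplied by an $n^b\times n^c$ matrix in $O(n^{\omega(a,b,c)})$ time; $\widetilde{O}$ hides polylogarithmic factors. *)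

(* Defs.v *)
From HB Require Import structures.
From mathcomp Require Import all_boot all_order all_algebra.
From mathcomp Require Import reals exp.

Set Implicit Arguments.
Unset Strict Implicit.
Unset Printing Implicit Defensive.

Import Order.TTheory GRing.Theory Num.Theory.

Local Open Scope ring_scope.

(* Complexity is measured by straight-line programs over F: the inputs are    *)
(* indexed by I, the outputs by O, and every instruction is one field         *)
(* operation. Reading inputs, constants of F and earlier results is free.     *)
(* Division is MathComp's total one (x / 0 = 0); over a fixed finite field    *)
(* it is x * y ^+ (#|F| - 2) for #|F| > 2 (and x * y for #|F| = 2), so it     *)
(* changes the cost by at most a constant factor depending on F only.         *)
Inductive operand (F I : Type) : Type :=
| Input of I
| Const of F
| Result of nat.
Arguments Input {F I} _.
Arguments Const {F I} _.
Arguments Result {F I} _.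

Inductive field_op : Type := OpAdd | OpSub | OpMul | OpDiv.

Record slp (F I O : Type) : Type := Slp {
  slp_code : seq (field_op * operand F I * operand F I);
  slp_out : O -> operand F I
}.

Definition slp_cost (F I O : Type) (p : slp F I O) : nat := size (slp_code p).

Definition apply_op (F : fieldType) (o : field_op) (x y : F) : F :=
  match o with
  | OpAdd => x + y
  | OpSub => x - y
  | OpMul => x * y
  | OpDiv => x / y
  end.

(* [v] lists the results of the instructions executed so far, oldest first. *)
Definition operand_val (F : fieldType) (I : Type) (x : I -> F) (v : seq F)
    (a : operand F I) : F :=
  match a with
  | Input i => x i
  | Const c => c
  | Result k => nth 0 v k
  end.

Definition slp_step (F : fieldType) (I : Type) (x : I -> F) (v : seq F)
    (ins : field_op * operand F I * operand F I) : seq F :=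
  let: (o, a, b) := ins in
  rcons v (apply_op o (operand_val x v a) (operand_val x v b)).

Definition slp_eval (F : fieldType) (I O : Type) (p : slp F I O) (x : I -> F)
    (o : O) : F :=
  operand_val x (foldl (slp_step x) [::] (slp_code p)) (slp_out p o).

Definition entries (F : Type) (m n : nat) (M : 'M[F]_(m, n)) :
    'I_m * 'I_n -> F := fun ij => M ij.1 ij.2.

Definition join_inputs (F I J : Type) (x : I -> F) (y : J -> F) : I + J -> F :=
  fun z => match z with inl i => x i | inr j => y j end.

Definition floor_pow (K : realType) (n : nat) (a : K) : nat :=
  Num.truncn (n%:R `^ a).

(* An n^a x n^b matrix can be multiplied by an n^b x n^c matrix over F in     *)
(* O(n^w) field operations.                                                   *)
Definition mm_exponent (K : realType) (F : fieldType) (a b c w : K) : Prop :=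
  exists C : K, forall n : nat, (0 < n)%N ->
    exists p : slp F
        ('I_(floor_pow n a) * 'I_(floor_pow n b)
         + 'I_(floor_pow n b) * 'I_(floor_pow n c))
        ('I_(floor_pow n a) * 'I_(floor_pow n c)),
      (slp_cost p)%:R <= C * n%:R `^ w /\
      forall (A : 'M[F]_(floor_pow n a, floor_pow n b))
             (B : 'M[F]_(floor_pow n b, floor_pow n c)),
        slp_eval p (join_inputs (entries A) (entries B)) =1 entries (A *m B).

Definition generic_mx (F : fieldType) (n : nat) (A : 'M[F]_n.+1) : Prop :=
  char_poly A = mxminpoly A.

(* The transpose of the library's [companionmx]: the coefficients are in the  *)
(* last column.                                                               *)
Definition companion (F : fieldType) (n : nat) (p : {poly F}) : 'M[F]_n.+1 :=
  \matrix_(i, j) if j == ord_max then - p`_i else (i == j.+1 :> nat)%:R.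

Definition frobenius_form (F : fieldType) (n : nat) (A U C : 'M[F]_n.+1) :
    Prop :=
  [/\ U \in unitmx, C = companion n (char_poly A) & A = U *m C *m invmx U].

Lemma window_subproof (n : nat) (k j : 'I_n) : (k + j < 2 * n - 1)%N.
Proof.
by case: n k j => [[]//|n] [k /= hk] [j /= hj]; rewrite mul2n doubleS subn1 /=
  -addnn ltnS leq_add.
Qed.

(* Columns k, ..., k + n - 1 of R, counted from 0. *)
Definition window (F : Type) (n : nat) (R : 'M[F]_(n, 2 * n - 1)) (k : 'I_n) :
    'M[F]_n :=
  colsub (fun j => Ordinal (window_subproof k j)) R.

Definition submx_of (F : Type) (n : nat) (S T : {set 'I_n}) (M : 'M[F]_n) :
    'M[F]_(#|S|, #|T|) :=
  mxsub enum_val enum_val M.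

(* Main.v *)
(* Write V for U^-1. Since A^k = (U C^k) V, the entry (i, j) of A^k is the
   correlation sum_l R(i, k + l) V(l, j). Cutting the range of l into about
   n^(1 - alpha) blocks of length H = 4 h turns all these sums, for k <= h, into
   coefficients of one product of a |S| x n^(1 - alpha) matrix by a
   n^(1 - alpha) x |T| matrix over F[X] whose entries have degree O(h).

   That product is computed with O(h polylog h) products of matrices over F by
   the Schoenhage-Strassen method: with L = l^e for a prime l different from the
   characteristic (l = 2, or l = 3 in characteristic 2), X is an L-th root of
   unity in F[X]/(X^L - 1), so splitting the polynomials into about L blocks and
   applying a radix-l FFT whose twiddle factors are free shifts replaces a product
   of degree about L^2 / l^3 by L products of degree L. The block products are
   then recovered modulo the cyclotomic polynomial of order L, modulo which X is
   a principal root of unity. Unrolled, the recursion costs polylog(h) * h matrix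
   products and polylog(h) * h additions per matrix entry.

   The additions are absorbed by the matrix products because any program for the
   product of a x b by b x c matrices has length at least
   (a b + b c + a c) / 3: it reads every input, and its outputs are distinct
   instructions. *)

Require Import Defs.
From HB Require Import structures.
From mathcomp Require Import all_boot all_order all_algebra.
From mathcomp Require Import reals exp.
From mathcomp Require Import ring lra zify.

Set Implicit Arguments.
Unset Strict Implicit.
Unset Printing Implicit Defensive.

Import Order.TTheory GRing.Theory Num.Theory.

Local Open Scope ring_scope.

(** * Straight-line programs *)

Lemma size_run (F : fieldType) (I : Type) (x : I -> F) v cd :
  size (foldl (slp_step x) v cd) = (size v + size cd)%N.
Proof.
elim: cd v => [|[[o a] b] cd IH] v /=; first by rewrite addn0.
by rewrite IH size_rcons addSnnS.
Qed.

Lemma nth_run (F : fieldType) (I : Type) (x : I -> F) v cd k :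
  (k < size v)%N -> nth 0 (foldl (slp_step x) v cd) k = nth 0 v k.
Proof.
elim: cd v => [|[[o a] b] cd IH] v //= hk.
by rewrite IH ?size_rcons ?(ltn_trans hk) // nth_rcons hk.
Qed.

(* A [Result] beyond the end of the code reads 0, but would change its meaning when
   the code is extended. *)
Definition valid_operand (F I : Type) (n : nat) (a : operand F I) : bool :=
  if a is Result k then (k < n)%N else true.

Section StraightLine.
Variables (F : fieldType) (I : Type).
Implicit Types (cd s : seq (field_op * operand F I * operand F I)).
Implicit Types (f g : (I -> F) -> F).

(** A single operand must serve all inputs [x], so what is tracked is a function of the whole input
    vector and the resulting program is oblivious to its values. *)
Definition avail cd f : Prop :=
  exists2 a : operand F I, valid_operand (size cd) a &
    forall x, operand_val x (foldl (slp_step x) [::] cd) a = f x.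

(** Programs are never written out: a goal asserts that some extension by at most [c] instructions
    reaches [H], and costs add up along [within_bind]. *)
Definition within (c : nat) cd (H : seq (field_op * operand F I * operand F I) -> Prop) : Prop :=
  exists2 s, (size s <= c)%N & H (cd ++ s).

Lemma avail_ext cd f g : f =1 g -> avail cd f -> avail cd g.
Proof. by move=> fg [a ha hx]; exists a => // x; rewrite hx. Qed.

Lemma avail_const cd (c : F) : avail cd (fun=> c).
Proof. by exists (Const c). Qed.

Lemma avail_input cd i : avail cd (fun x => x i).
Proof. by exists (Input i). Qed.

Lemma avail_cat cd s f : avail cd f -> avail (cd ++ s) f.
Proof.
case=> a ha hx; exists a => [|x].
  by case: a ha {hx} => //= k; rewrite size_cat => /leq_trans-> //; rewrite leq_addr.
rewrite -hx foldl_cat; case: a ha {hx} => //= k hk.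
by rewrite nth_run // size_run.
Qed.

Lemma within_done cd (H : _ -> Prop) : H cd -> within 0 cd H.
Proof. by exists [::]; rewrite ?cats0. Qed.

Lemma within_le c c' cd (H : _ -> Prop) :
  (c <= c')%N -> within c cd H -> within c' cd H.
Proof. by move=> hc [s hs Hs]; exists s => //; apply: leq_trans hc. Qed.

Lemma within_imp c cd (H H' : _ -> Prop) :
  (forall s, H (cd ++ s) -> H' (cd ++ s)) -> within c cd H -> within c cd H'.
Proof. by move=> hH [s hs Hs]; exists s => //; apply: hH. Qed.

Lemma within_bind c c' cd (H H' : _ -> Prop) :
  within c cd H -> (forall s, H (cd ++ s) -> within c' (cd ++ s) H') ->
  within (c + c') cd H'.
Proof.
move=> [s hs Hs] /(_ s Hs) [s' hs' Hs']; exists (s ++ s'); last by rewrite catA.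
by rewrite size_cat leq_add.
Qed.

Lemma within_op o cd f g :
  avail cd f -> avail cd g ->
  within 1 cd (fun cd' => avail cd' (fun x => apply_op o (f x) (g x))).
Proof.
move=> [a ha hf] [b hb hg]; exists [:: (o, a, b)] => //.
exists (Result (size cd)); first by rewrite /= size_cat addn1.
by move=> x; rewrite foldl_cat /= nth_rcons size_run /= add0n ltnn eqxx hf hg.
Qed.

(** The members are handled one after another. Each must therefore be reachable from any extension
    [s] of [cd] and must survive the code appended after it. *)
Lemma within_family (T : finType) (c : nat) cd (H : T -> _ -> Prop) :
  (forall t cd s, H t cd -> H t (cd ++ s)) ->
  (forall t s, within c (cd ++ s) (H t)) ->
  within (#|T| * c) cd (fun cd' => forall t, H t cd').
Proof.
move=> Hcat hH; rewrite cardE.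
suff: within (size (enum T) * c) cd (fun cd' => forall t, t \in enum T -> H t cd').
  by apply: within_imp => s Hs t; apply: Hs; rewrite mem_enum.
elim: (enum T) => [|t0 r IH]; first exact: within_done.
rewrite mulSn addnC; apply: within_bind IH _ => s Hs.
apply: within_imp (hH t0 s) => s' H0 t; rewrite in_cons => /predU1P[-> //|tr].
by apply: Hcat; apply: Hs.
Qed.

Lemma within_sum (n : nat) cd (f : nat -> (I -> F) -> F) :
  (forall k, (k < n)%N -> avail cd (f k)) ->
  within n cd (fun cd' => avail cd' (fun x => \sum_(k < n) f k x)).
Proof.
elim: n => [|n IH] hf.
  apply: within_done; apply: avail_ext (avail_const cd 0) => x.
  by rewrite big_ord0.
rewrite -{1}addn1; apply: within_bind (IH _) _ => [k /ltnW|s Hs]; first exact: hf.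
apply: within_imp (within_op OpAdd Hs (avail_cat s (hf n _))) => // s'.
by apply: avail_ext => x; rewrite big_ord_recr.
Qed.

Definition subst_operand (n : nat) (I' : Type) (sub : I' -> operand F I)
    (a : operand F I') : operand F I :=
  match a with
  | Input i => sub i
  | Const c => Const c
  | Result k => Result (n + k)
  end.

(** Inlining of [p]: its inputs become operands already available, and its results are renumbered by
    the length of the code in front. *)
Lemma within_subst (I' : finType) (O : Type) (p : slp F I' O) cd (g : I' -> (I -> F) -> F) :
  (forall i, avail cd (g i)) ->
  within (slp_cost p) cd (fun cd' =>
    forall o, avail cd' (fun x => slp_eval p (g^~ x) o)).
Proof.
move=> hg.
have [|sub hsub] := @fin_all_exists I' (fun=> operand F I) (fun i a =>
    valid_operand (size cd) a /\
    forall x, operand_val x (foldl (slp_step x) [::] cd) a = g i x).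
  by move=> i; have [a] := hg i; exists a.
pose tr (ins : field_op * operand F I' * operand F I') :=
  let: (o, a, b) := ins in
  (o, subst_operand (size cd) sub a, subst_operand (size cd) sub b).
have val_tr x v a : operand_val x (foldl (slp_step x) [::] cd ++ v)
    (subst_operand (size cd) sub a) = operand_val (g^~ x) v a.
  case: a => //= [i|k]; last by rewrite nth_cat size_run ltnNge leq_addr /= addKn.
  have [vi <-] := hsub i; case: (sub i) vi => //= k hk.
  by rewrite nth_cat size_run hk.
have run_tr x v (s : seq (field_op * operand F I' * operand F I')) :
    foldl (slp_step x) (foldl (slp_step x) [::] cd ++ v) (map tr s)
    = foldl (slp_step x) [::] cd ++ foldl (slp_step (g^~ x)) v s.
  by elim: s v => [|[[o a] b] s IH] v //=; rewrite !val_tr rcons_cat IH.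
exists (map tr (slp_code p)); first by rewrite size_map.
move=> o.
case: (boolP (valid_operand (size (slp_code p)) (slp_out p o))) => hv.
  exists (subst_operand (size cd) sub (slp_out p o)).
    rewrite size_cat size_map; case: (slp_out p o) hv => //= [i _|k hk].
      have [] := hsub i; case: (sub i) => //= k hk _.
      by rewrite (leq_trans hk) ?leq_addr.
    by rewrite ltn_add2l.
  move=> x; rewrite foldl_cat; have := run_tr x [::] (slp_code p).
  by rewrite cats0 => ->; rewrite val_tr.
(* An output that points past the end of [p] reads the default 0, which is available as a
   constant. *)
apply: avail_ext (avail_const _ 0) => x; rewrite /slp_eval.
case: (slp_out p o) hv => //= k; rewrite -leqNgt => hk.
by rewrite nth_default // size_run.
Qed.

Lemma slp_of_within (O : finType) (c : nat) (g : O -> (I -> F) -> F) :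
  within c [::] (fun cd => forall o, avail cd (g o)) ->
  exists2 p : slp F I O, (slp_cost p <= c)%N & forall x o, slp_eval p x o = g o x.
Proof.
case=> cd hc /= hg.
have [|out hout] := @fin_all_exists O (fun=> operand F I) (fun o a =>
    forall x, operand_val x (foldl (slp_step x) [::] cd) a = g o x).
  by move=> o; have [a] := hg o; exists a.
by exists (Slp cd out) => // x o; apply: hout.
Qed.

End StraightLine.

(** * Polynomials modulo X^L - 1 and cyclotomic polynomials *)

Section PolyAlgebra.
Variable F : fieldType.
Implicit Types (p q r d z : {poly F}).

Lemma size_sum_leq (J : finType) (N : nat) (c : J -> {poly F}) :
  (forall j, (size (c j) <= N)%N) -> (size (\sum_j c j)%R <= N)%N.
Proof. by move=> hc; apply: (leq_trans (size_sum _ _ _)); apply/bigmax_leqP. Qed.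

Lemma coef_blocks (B n : nat) (c : nat -> {poly F}) v :
  (0 < B)%N -> (forall m, (size (c m) <= B)%N) ->
  (\sum_(m < n) 'X^(B * m) * c m)`_v =
    if (v %/ B < n)%N then (c (v %/ B)%N)`_(v %% B)%N else 0.
Proof.
move=> B0 hc; rewrite coef_sum.
have term m : ('X^(B * m) * c m)`_v = if (v %/ B == m)%N then (c m)`_(v %% B)%N else 0.
  rewrite coefXnM; case: ltnP => hv.
    by rewrite ifN //; apply: contraTneq hv => <-; rewrite -leqNgt mulnC leq_trunc_div.
  case: eqP => [<-|hne]; first by congr nth; rewrite {1}(divn_eq v B) mulnC addKn.
  rewrite nth_default // (leq_trans (hc m)) // leq_subRL //.
  have : (m < v %/ B)%N.
    by rewrite ltn_neqAle eq_sym (introF eqP hne) /= leq_divRL // mulnC.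
  by rewrite leq_divRL // mulSn addnC mulnC.
under eq_bigr do rewrite term.
case: ltnP => hv; last first.
  by rewrite big1 // => m _; rewrite ifN // gtn_eqF // (leq_trans (ltn_ord m)).
rewrite (bigD1 (Ordinal hv)) //= eqxx big1 ?addr0 // => m hm.
by rewrite ifN // eq_sym; apply: contraNneq hm => h; apply/eqP/val_inj.
Qed.

(** Each piece reaches only into the next block, so a coefficient receives at most two
    contributions: reassembling a product from its block products costs one addition per
    coefficient. *)
Lemma coef_overlap (B n : nat) (c : nat -> {poly F}) v :
  (0 < B)%N -> (v %/ B < n)%N -> (forall m, (size (c m) <= B + B)%N) ->
  (\sum_(m < n) 'X^(B * m) * c m)`_v =
    (take_poly B (c (v %/ B)%N))`_(v %% B)%N
    + (if (v %/ B)%N is q.+1 then (c q)`_(v %% B + B)%N else 0).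
Proof.
move=> B0 hv hc.
have -> : \sum_(m < n) 'X^(B * m) * c m =
    \sum_(m < n) 'X^(B * m) * take_poly B (c m)
    + 'X^B * \sum_(m < n) 'X^(B * m) * drop_poly B (c m).
  rewrite mulr_sumr -big_split; apply: eq_bigr => m _.
  by rewrite -{1}(poly_take_drop B (c m)) /=; ring.
rewrite coefD (@coef_blocks B n (fun m => take_poly B (c m))) // ?hv; last first.
  by move=> m; apply: size_take_poly.
rewrite coefXnM (@coef_blocks B n (fun m => drop_poly B (c m))) //; last first.
  by move=> m; rewrite size_drop_poly leq_subLR.
congr (_ + _); case: ltnP => hB; first by rewrite divn_small.
have -> : (v %/ B = ((v - B) %/ B).+1)%N by rewrite -{1}(subnK hB) divnDr // divnn B0 addn1.
have -> : (v %% B = (v - B) %% B)%N by rewrite -{1}(subnK hB) modnDr.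
rewrite coef_drop_poly ifT //; apply: leq_ltn_trans hv.
by rewrite leq_div2r // leq_subr.
Qed.

Lemma coef_mod_cyclic (L : nat) p u : (0 < L)%N -> (size p <= L + L)%N ->
  (p %% ('X^L - 1))`_u = if (u < L)%N then p`_u + p`_(u + L)%N else 0.
Proof.
move=> L0 hp.
have -> : p %% ('X^L - 1) = take_poly L p + drop_poly L p.
  apply/esym; apply: (@modpP _ _ (drop_poly L p)).
    by rewrite -{1}(poly_take_drop L p); ring.
  rewrite -[1]polyC1 size_XnsubC // ltnS (leq_trans (size_polyD _ _)) //.
  by rewrite geq_max size_take_poly size_drop_poly leq_subLR.
rewrite coefD coef_take_poly coef_drop_poly; case: ltnP => // hu.
by rewrite add0r nth_default // (leq_trans hp) // leq_add2r.
Qed.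

Lemma size_mod_cyclic (L : nat) p : (0 < L)%N -> (size (p %% ('X^L - 1))%R <= L)%N.
Proof.
move=> L0; have := ltn_modp p ('X^L - 1).
by rewrite -size_poly_gt0 -[1]polyC1 size_XnsubC.
Qed.

Lemma eq_mod_dvdp p q d : d %| p - q -> p %% d = q %% d.
Proof. by move/modp_eq0P; rewrite modpD modpN => /subr0_eq. Qed.

Lemma dvdp_Xn_sub1 (a L : nat) : (L %| a)%N -> ('X^L - 1 : {poly F}) %| 'X^a - 1.
Proof.
move=> /dvdnP[b ->]; rewrite mulnC exprM (subrX1 ('X^L : {poly F})).
by rewrite dvdp_mulr.
Qed.

Lemma eq_mod_cyclic (a b L : nat) p : a = b %[mod L] ->
  ('X^a * p) %% ('X^L - 1) = ('X^b * p) %% ('X^L - 1).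
Proof.
wlog hab : a b / (b <= a)%N.
  by case: (leqP b a) => [? H|/ltnW ? H]; [apply: H|move/esym => ?; apply/esym/H].
move/eqP; rewrite eqn_mod_dvd // => hd; apply: eq_mod_dvdp.
have -> : 'X^a * p - 'X^b * p = ('X^(a - b) - 1) * ('X^b * p).
  by rewrite mulrBl mul1r mulrA -exprD subnK.
by rewrite dvdp_mulr // dvdp_Xn_sub1.
Qed.

(* For [l] prime and [M] a power of [l], the cyclotomic polynomial of order [l * M]. *)
Definition cyclo (l M : nat) : {poly F} := \sum_(a < l) 'X^(M * a).

Lemma mul_cyclo (l M : nat) : cyclo l M * ('X^M - 1) = 'X^(M * l) - 1.
Proof.
rewrite mulrC exprM (subrX1 ('X^M : {poly F})); congr (_ * _).
by apply: eq_bigr => a _; rewrite exprM.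
Qed.

Lemma size_cyclo (l M : nat) : (0 < l)%N -> (0 < M)%N -> size (cyclo l M) = (M * l.-1).+1.
Proof.
move=> l0 M0.
have M1 : size ('X^M - 1 : {poly F}) = M.+1 by rewrite -[1]polyC1 size_XnsubC.
have nz : cyclo l M != 0.
  apply: contraTneq (isT : true) => h; have := mul_cyclo l M.
  rewrite h mul0r => /eqP; rewrite eq_sym -size_poly_eq0 -[1]polyC1 size_XnsubC //.
  by rewrite muln_gt0 M0.
have := congr1 (fun p : {poly F} => size p) (mul_cyclo l M).
rewrite size_mul // ?M1; last by rewrite -size_poly_eq0 M1.
rewrite -[1]polyC1 size_XnsubC ?muln_gt0 ?M0 //; case: l l0 {nz} => // l _.
by rewrite /= mulnS addnS /= -addnS addnC => /addnI.
Qed.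

(** Let [t] be the part of [d] from degree [M * l.-1] on. The product [cyclo l M * t] consists of
    [l] adjacent copies of [t], the last of which cancels the top of [d], so reduction costs one
    subtraction per coefficient. The remainder is unique because [cyclo l M] has degree
    [M * l.-1]. *)
Lemma coef_mod_cyclo (l M : nat) d r z u : (0 < l)%N -> (0 < M)%N ->
  (size d <= M * l)%N -> (size r <= M * l.-1)%N -> d = r + cyclo l M * z ->
  r`_u = if (u < M * l.-1)%N then d`_u - d`_(u %% M + M * l.-1)%N else 0.
Proof.
move=> l0 M0 hd hr edz; pose t := drop_poly (M * l.-1) d.
have ht : (size t <= M)%N by rewrite size_drop_poly leq_subLR -mulnSr prednK.
have ct v : (cyclo l M * t)`_v = if (v %/ M < l)%N then t`_(v %% M)%N else 0.
  by rewrite /cyclo mulr_suml (@coef_blocks M l (fun=> t)).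
have hs : (size (d - cyclo l M * t)%R <= M * l.-1)%N.
  apply/leq_sizeP => v hv; rewrite coefB ct coef_drop_poly.
  case: ltnP => hvM; last first.
    rewrite nth_default ?subr0 //; apply: leq_trans hd _.
    by rewrite mulnC -leq_divRL.
  have e : (v %/ M = l.-1)%N.
    apply/eqP; rewrite eqn_leq -ltnS prednK // hvM leq_divRL // mulnC hv //.
  by rewrite {1}(divn_eq v M) e addnC mulnC subrr.
have -> : r = d - cyclo l M * t.
  apply/subr0_eq/eqP; apply: contraTT (isT : true) => hne.
  have dv : cyclo l M %| r - (d - cyclo l M * t).
    have -> : r - (d - cyclo l M * t) = cyclo l M * (t - z) by rewrite edz; ring.
    exact: dvdp_mulr.
  have := dvdp_leq hne dv; rewrite size_cyclo // leqNgt ltnS.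
  rewrite (leq_trans (size_polyD _ _)) // size_polyN geq_max hr //.
case: ltnP => hu; last by rewrite nth_default // (leq_trans hs).
rewrite coefB ct coef_drop_poly ifT // ltn_divLR // mulnC (leq_trans hu) //.
by rewrite leq_mul2l leq_pred orbT.
Qed.

(** The quotient by [Phi] need not be a field, so the factor ['X^D - 1] cannot simply be cancelled
    from the geometric sum. Instead, ['X^M - 1] is shown to annihilate [S] modulo [Phi]; as [Phi] is
    congruent to [l] modulo ['X^M - 1], also [l * S] vanishes, and [l] is invertible. *)
Lemma dvdp_cyclo_sum (l e D : nat) : prime l -> l%:R != 0 :> F ->
  ~~ (l ^ e.+1 %| D)%N ->
  cyclo l (l ^ e) %| \sum_(a < l ^ e.+1) 'X^(D * a).
Proof.
move=> lP l0 hD; set Phi := cyclo l _; set L := (l ^ e.+1)%N.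
set S := \sum_(a < _) _; pose M := (l ^ e)%N.
have PhiL : Phi %| 'X^L - 1 by rewrite /L expnSr -mul_cyclo dvdp_mulr.
have PhiS : Phi %| ('X^D - 1) * S.
  have -> : ('X^D - 1) * S = 'X^(D * L) - 1.
    rewrite exprM (subrX1 ('X^D : {poly F})); congr (_ * _).
    by apply: eq_bigr => a _; rewrite exprM.
  by apply: dvdp_trans PhiL _; apply: dvdp_Xn_sub1; rewrite dvdn_mull.
(* [gcd(D, L)] divides [M], so [X^M - 1] is a multiple of [X^D - 1] modulo [X^L - 1]. *)
have D0 : (0 < D)%N by rewrite lt0n; apply: contraNneq hD => ->; rewrite dvdn0.
have gM : (gcdn D L %| M)%N.
  have /(dvdn_pfactor _ _ lP)[v] := dvdn_gcdr D L.
  rewrite leq_eqVlt => /predU1P[-> gL|ve ->]; last by rewrite dvdn_exp2l.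
  by rewrite -gL dvdn_gcdl in hD.
have [u hu] : exists u, (D * u = M %[mod L])%N.
  case: (egcdnP L D0) => km kn ekm _; have /dvdnP[w ->] := gM.
  by exists (w * km)%N; rewrite mulnCA [(D * km)%N]mulnC ekm mulnDr mulnA modnMDl.
have PhiM : Phi %| ('X^M - 1) * S.
  have -> : ('X^M - 1) * S = ('X^M * 1 - 'X^(D * u) * 1) * S + ('X^(D * u) - 1) * S.
    by ring.
  apply: dvdp_add.
    apply: dvdp_mulr; apply: dvdp_trans PhiL _.
    by apply/modp_eq0P; rewrite modpD modpN (eq_mod_cyclic _ hu) subrr.
  apply: dvdp_trans PhiS _; apply: dvdp_mul => //.
  by apply: dvdp_Xn_sub1; rewrite dvdn_mulr.
have dl : 'X^M - 1 %| Phi - l%:R.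
  have -> : Phi - l%:R = \sum_(a < l) ('X^(M * a) - 1).
    by rewrite sumrB sumr_const card_ord.
  elim/big_ind: _ => [|p q|a _]; [exact: dvdp0|exact: dvdp_add|].
  by apply: dvdp_Xn_sub1; rewrite dvdn_mulr.
have : Phi %| l%:R *: S.
  have -> : l%:R *: S = Phi * S - (Phi - l%:R) * S.
    by rewrite mulrBl opprB addrC subrK scaler_nat mulr_natl.
  apply: dvdp_sub; first exact: dvdp_mulr.
  have /dvdpP[w ->] := dl.
  by rewrite -mulrA dvdp_mull.
by rewrite dvdpZr.
Qed.

End PolyAlgebra.

(** * Fast Fourier transform of polynomial matrices *)

Section PolyMatrixCircuits.
Variables (F : fieldType) (I : Type).
Implicit Types (cd s : seq (field_op * operand F I * operand F I)).

(** The index [u] is unbounded: coefficients beyond the degree are the constant 0 and cost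
    nothing. *)
Definition knows (a b : nat) cd (P : (I -> F) -> 'M[{poly F}]_(a, b)) : Prop :=
  forall i j u, avail cd (fun x => (P x i j)`_u).

Definition deg_le (a b N : nat) (P : (I -> F) -> 'M[{poly F}]_(a, b)) : Prop :=
  forall x i j, (size (P x i j) <= N)%N.

Lemma knows_cat (a b : nat) cd s (P : (I -> F) -> 'M[{poly F}]_(a, b)) :
  knows cd P -> knows (cd ++ s) P.
Proof. by move=> h i j u; apply: avail_cat. Qed.

Lemma knows_ext (a b : nat) cd (P Q : (I -> F) -> 'M[{poly F}]_(a, b)) :
  P =1 Q -> knows cd P -> knows cd Q.
Proof. by move=> e h i j u; apply: avail_ext (h i j u) => x; rewrite e. Qed.

Lemma within_knows (a b N c : nat) cd (P : (I -> F) -> 'M[{poly F}]_(a, b)) :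
  deg_le N P ->
  (forall i j u s, (u < N)%N ->
     within c (cd ++ s) (fun cd' => avail cd' (fun x => (P x i j)`_u))) ->
  within (a * b * N * c) cd (fun cd' => knows cd' P).
Proof.
move=> hN hP.
have := @within_family F I ('I_a * 'I_b * 'I_N)%type c cd
  (fun t cd' => avail cd' (fun x => (P x t.1.1 t.1.2)`_t.2)).
rewrite !card_prod !card_ord => h; apply: within_imp (h _ _).
- move=> s hs i j u; case: (ltnP u N) => hu; first exact: (hs (i, j, Ordinal hu)).
  by apply: avail_ext (avail_const _ 0) => x; rewrite nth_default // (leq_trans (hN x i j)).
- by move=> t cd' s'; apply: avail_cat.
by case=> [[i j] u] s; apply: hP.
Qed.

Lemma within_knows_family (a b n c : nat) cd
    (P : nat -> (I -> F) -> 'M[{poly F}]_(a, b)) :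
  (forall k s, (k < n)%N -> within c (cd ++ s) (fun cd' => knows cd' (P k))) ->
  within (n * c) cd (fun cd' => forall k, (k < n)%N -> knows cd' (P k)).
Proof.
move=> h; have := @within_family F I 'I_n c cd (fun k cd' => knows cd' (P k)).
rewrite card_ord => h'; apply: within_imp (h' _ _).
- by move=> s hs k kn; apply: (hs (Ordinal kn)).
- by move=> t cd' s'; apply: knows_cat.
by move=> k s; apply: h.
Qed.

Definition mod_mx (d : {poly F}) (a b : nat) (P : 'M[{poly F}]_(a, b)) :
    'M[{poly F}]_(a, b) := map_mx (fun p => p %% d) P.

Lemma mod_mx_sum (d : {poly F}) (a b n : nat) (P : 'I_n -> 'M[{poly F}]_(a, b)) :
  mod_mx d (\sum_(k < n) P k) = \sum_(k < n) mod_mx d (P k).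
Proof.
apply/matrixP => i j; rewrite mxE !summxE.
rewrite (big_morph (fun p => p %% d) (modpD _) (mod0p _)).
by apply: eq_bigr => k _; rewrite mxE.
Qed.

Lemma mod_mx_scale (d p : {poly F}) (a b : nat) (P : 'M[{poly F}]_(a, b)) :
  mod_mx d (p *: mod_mx d P) = mod_mx d (p *: P).
Proof. by apply/matrixP => i j; rewrite !mxE modp_mul. Qed.

Lemma mod_mx_scalel (d p q : {poly F}) (a b : nat) (P : 'M[{poly F}]_(a, b)) :
  d %| p - q -> mod_mx d (p *: P) = mod_mx d (q *: P).
Proof.
move=> hpq; apply/matrixP => i j; rewrite !mxE; apply: eq_mod_dvdp.
by rewrite -mulrBl dvdp_mulr.
Qed.

Lemma mod_mx_mul (d : {poly F}) (a b c : nat) (P : 'M[{poly F}]_(a, b))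
    (Q : 'M[{poly F}]_(b, c)) :
  mod_mx d (mod_mx d P *m mod_mx d Q) = mod_mx d (P *m Q).
Proof.
apply/matrixP => i j; rewrite !mxE.
rewrite !(big_morph (fun p => p %% d) (modpD _) (mod0p _)).
by apply: eq_bigr => k _; rewrite !mxE modp_mul mulrC modp_mul mulrC.
Qed.

Lemma mod_mx_dvd (d d' : {poly F}) (a b : nat) (P : 'M[{poly F}]_(a, b)) :
  d' %| d -> mod_mx d' (mod_mx d P) = mod_mx d' P.
Proof.
move=> hd; apply/matrixP => i j; rewrite !mxE; apply/esym/eq_mod_dvdp.
by rewrite {1}(divp_eq (P i j) d) addrK dvdp_mull.
Qed.

Local Notation mod_cyclic L := (mod_mx ('X^L - 1)).

Lemma mod_cyclic_small (L a b : nat) (P : 'M[{poly F}]_(a, b)) : (0 < L)%N ->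
  (forall i j, (size (P i j) <= L)%N) -> mod_cyclic L P = P.
Proof.
move=> L0 h; apply/matrixP => i j; rewrite mxE modp_small //.
by rewrite -[1]polyC1 size_XnsubC // ltnS.
Qed.

(** Modulo ['X^L - 1], multiplication by a power of ['X] rotates the coefficients cyclically. It
    only renames operands, so the twiddle factors are free. *)
Lemma knows_shift (L k a b : nat) cd (P : (I -> F) -> 'M[{poly F}]_(a, b)) :
  (0 < L)%N -> deg_le L P -> knows cd P ->
  knows cd (fun x => mod_cyclic L ('X^k *: P x)).
Proof.
move=> L0 hL hP; elim: k => [|k IH].
  apply: knows_ext hP => x; rewrite expr0 scale1r mod_cyclic_small //.
apply: (knows_ext (P := fun x => mod_cyclic L ('X *: mod_cyclic L ('X^k *: P x)))).
  by move=> x; rewrite mod_mx_scale scalerA -exprS.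
pose Q x := mod_cyclic L ('X^k *: P x); move=> i j u.
have sQ x : (size (Q x i j) <= L)%N by rewrite mxE size_mod_cyclic.
have e x : (mod_cyclic L ('X *: Q x) i j)`_u =
    if (u < L)%N then (if u is u'.+1 then (Q x i j)`_u' else (Q x i j)`_L.-1) else 0.
  rewrite 2!mxE coef_mod_cyclic //; last first.
    apply: leq_trans (size_polyMleq _ _) _; rewrite size_polyX /=.
    by have := sQ x; move: (size (Q x i j)) => m; lia.
  case: ltnP => // hu; rewrite !coefXM; case: u hu => [|u] hu /=.
    by rewrite add0n add0r gtn_eqF.
  by rewrite [X in _ + X]nth_default ?addr0 // (leq_trans (sQ x)) // leq_addl.
apply: (avail_ext (fun x => esym (e x))).
by case: ltnP => _; [case: u {e} => [|u]; apply: IH | apply: avail_const].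
Qed.

(* The value at [Y = X^(r * t)] of the polynomial in [Y] with coefficients [u k]. *)
Definition dft (L r n a b : nat) (u : nat -> 'M[{poly F}]_(a, b)) (t : nat) :
    'M[{poly F}]_(a, b) :=
  mod_cyclic L (\sum_(k < n) 'X^(r * t * k) *: u k).

Lemma big_ord_mul (V : nmodType) (l n : nat) (f : nat -> V) :
  \sum_(k < l * n) f k = \sum_(q < l) \sum_(k < n) f (l * k + q)%N.
Proof.
rewrite exchange_big /=; elim: n => [|n IH]; first by rewrite muln0 !big_ord0.
rewrite big_ord_recr /= -IH mulnSr big_split_ord /=.
by congr (_ + _).
Qed.

(** Radix-[l] decimation: the indices are sorted by their residue [q] modulo [l], and each class is
    a transform at the root ['X^(r * l)]. *)
Lemma dft_split (L r l n a b : nat) (u : nat -> 'M[{poly F}]_(a, b)) (t : nat) :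
  dft L r (l * n) u t = \sum_(q < l) mod_cyclic L ('X^(r * t * q) *:
      dft L (r * l) n (fun k => u (l * k + q)%N) t).
Proof.
rewrite /dft (big_ord_mul l n (fun k => 'X^(r * t * k) *: u k)) mod_mx_sum.
apply: eq_bigr => q _; rewrite mod_mx_scale scaler_sumr; congr mod_mx.
apply: eq_bigr => k _; rewrite scalerA -exprD; congr ('X^_ *: _); ring.
Qed.

Lemma dft_mod (L r n N a b : nat) (u : nat -> 'M[{poly F}]_(a, b)) (t : nat) :
  (L %| r * N)%N -> dft L r n u (t %% N) = dft L r n u t.
Proof.
move=> hL; apply/matrixP => i j; rewrite /dft !mod_mx_sum !summxE.
apply: eq_bigr => k _; rewrite !mxE; apply: eq_mod_cyclic.
rewrite [in RHS](divn_eq t N) mulnDr mulnDl.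
have /dvdnP[w] := hL; rewrite mulnCA => ->.
have -> : (t %/ N * (w * L) * k = t %/ N * w * k * L)%N by ring.
by rewrite modnMDl.
Qed.

(** Each of the [e] levels of the recursion produces [l ^ e] matrices with [a * b * L] coefficients,
    each a sum of [l] rotated coefficients of the level below. *)
Lemma within_dft (L l e r a b : nat) cd
    (u : nat -> (I -> F) -> 'M[{poly F}]_(a, b)) :
  (0 < L)%N -> (0 < l)%N -> (L %| r * l ^ e)%N ->
  (forall k, (k < l ^ e)%N -> deg_le L (u k)) ->
  (forall k, (k < l ^ e)%N -> knows cd (u k)) ->
  within (e * l ^ e * (a * b * L * l)) cd (fun cd' =>
    forall t, knows cd' (fun x => dft L r (l ^ e) (u^~ x) t)).
Proof.
move=> L0 l0; elim: e r u cd => [|e IH] r u cd hL hdeg hu.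
  apply: within_done => t; apply: knows_ext (hu 0%N _) => // x.
  by rewrite /dft big_ord1 muln0 scale1r mod_cyclic_small // => i j; apply: hdeg.
have -> : (e.+1 * l ^ e.+1 * (a * b * L * l) =
    l * (e * l ^ e * (a * b * L * l)) + l ^ e.+1 * (a * b * L * l))%N.
  by rewrite expnS; ring.
pose v q k := u (l * k + q)%N.
have hv q k : (q < l)%N -> (k < l ^ e)%N -> (l * k + q < l ^ e.+1)%N.
  move=> hq hk; apply: (@leq_trans (l * k.+1)%N); first by rewrite mulnSr ltn_add2l.
  by rewrite expnS leq_mul2l hk orbT.
have step1 : within (l * (e * l ^ e * (a * b * L * l))) cd (fun cd' =>
    forall q : 'I_l, forall t, knows cd' (fun x => dft L (r * l) (l ^ e) ((v q)^~ x) t)).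
  have := @within_family F I 'I_l (e * l ^ e * (a * b * L * l)) cd (fun q cd' =>
    forall t, knows cd' (fun x => dft L (r * l) (l ^ e) ((v q)^~ x) t)).
  rewrite card_ord; apply.
    by move=> q cd' s h t; apply: knows_cat.
  move=> q s; apply: IH => [|k hk|k hk].
  - by rewrite -mulnA -expnS.
  - by apply: hdeg; apply: hv.
  - by apply: knows_cat; apply: hu; apply: hv.
apply: within_bind step1 _ => s hs.
(* The transform is periodic in [t], so computing one period makes it available for every [t]. *)
apply: (within_imp (H := fun cd' => forall t, (t < l ^ e.+1)%N ->
    knows cd' (fun x => dft L r (l ^ e.+1) (u^~ x) t))).
  move=> s' hs' t; apply: knows_ext (hs' (t %% l ^ e.+1)%N _) => [x|].
    exact: dft_mod.
  by rewrite ltn_pmod // expn_gt0 l0.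
apply: within_knows_family => t s' _; apply: within_knows.
  by move=> x i j; rewrite mxE size_mod_cyclic.
move=> i j w s2 _.
have := @within_sum F I l ((((cd ++ s) ++ s') ++ s2)) (fun q x =>
   (mod_cyclic L ('X^(r * t * q) *: dft L (r * l) (l ^ e) ((v q)^~ x) t) i j)`_w).
move=> h; apply: within_imp (h _) => [s3|q hq].
  apply: avail_ext => x; rewrite expnS dft_split summxE coef_sum.
  by apply: eq_bigr => q _.
apply: knows_shift => //; first by move=> x i' j'; rewrite mxE size_mod_cyclic.
do 2 apply: knows_cat.
exact: (hs (Ordinal hq)).
Qed.

End PolyMatrixCircuits.

(** * Product of polynomial matrices *)

Section PolyMatrixProduct.
Variable F : fieldType.

(** The hypothesis excludes wrap-around, so no product is lost by truncating at [n]. It is applied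
    with [y] a power ['X^t] for the transforms and with [y = 'X^B] for the reassembly. *)
Lemma mulmx_sum_powers (R : comNzRingType) (a b c n : nat) (y : R)
    (f : nat -> 'M[R]_(a, b)) (g : nat -> 'M[R]_(b, c)) :
  (forall k k', (n <= k + k')%N -> f k *m g k' = 0) ->
  (\sum_(k < n) y ^+ k *: f k) *m (\sum_(k < n) y ^+ k *: g k) =
  \sum_(m < n) y ^+ m *: (\sum_(k < n) \sum_(k' < n | (k + k' == m)%N) f k *m g k').
Proof.
move=> h0.
have -> : \sum_(m < n) y ^+ m *:
      (\sum_(k < n) \sum_(k' < n | (k + k' == m)%N) f k *m g k') =
    \sum_(k < n) \sum_(k' < n) \sum_(m < n)
      (if (k + k' == m)%N then y ^+ m *: (f k *m g k') else 0).
  under [RHS]eq_bigr do rewrite exchange_big.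
  rewrite [RHS]exchange_big /=; apply: eq_bigr => m _; rewrite scaler_sumr.
  apply: eq_bigr => k _; rewrite scaler_sumr -big_mkcond /=.
  by apply: eq_bigr.
rewrite mulmx_suml; apply: eq_bigr => k _; rewrite mulmx_sumr.
apply: eq_bigr => k' _; rewrite -scalemxAl -scalemxAr scalerA -exprD.
case: (ltnP (k + k') n) => hk.
  rewrite (bigD1 (Ordinal hk)) //= eqxx big1 ?addr0 // => m hm.
  by rewrite ifN // eq_sym; apply: contraNneq hm => h; apply/eqP/val_inj.
rewrite h0 // scaler0 big1 // => m _; rewrite ifN //.
by rewrite gtn_eqF // (leq_trans (ltn_ord m)).
Qed.

(** Orthogonality of the powers of ['X]. The factor [L.-1] stands for -1 modulo [L], so the exponent
    is that of ['X^(m' - m)]. *)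
Lemma sum_cyclic_roots (l e m m' : nat) : prime l -> l%:R != 0 :> F ->
  (m < l ^ e.+1)%N -> (m' < l ^ e.+1)%N ->
  cyclo F l (l ^ e) %| \sum_(a < l ^ e.+1) 'X^(((l ^ e.+1).-1 * m + m') * a)
     - (if m == m' then (l ^ e.+1)%:R else 0).
Proof.
move=> lP l0 hm hm'; set L := (l ^ e.+1)%N.
have L0 : (0 < L)%N by rewrite expn_gt0 prime_gt0.
have eL : (L.-1 * m + m' + m = L * m + m')%N.
  by rewrite -{2}(prednK L0) mulSn; ring.
case: eqP => [<-|hne].
  apply: (@dvdp_trans _ ('X^L - 1)); first by rewrite /L expnSr -mul_cyclo dvdp_mulr.
  have -> : (L%:R : {poly F}) = \sum_(a < L) 1 by rewrite sumr_const card_ord.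
  rewrite -sumrB; elim/big_ind: _ => [|p q|a _]; [exact: dvdp0|exact: dvdp_add|].
  apply: dvdp_Xn_sub1; rewrite dvdn_mulr //.
  by rewrite -mulSnr prednK // dvdn_mulr.
rewrite subr0; apply: dvdp_cyclo_sum => //; rewrite -/L.
apply/negP => hd; apply: hne; rewrite -(modn_small hm) -(modn_small hm') -/L.
apply/eqP; rewrite -(modnMDl m m') [(m * L)%N]mulnC -eL.
by have /dvdnP[w ->] := hd; rewrite modnMDl.
Qed.

Lemma size_mulmx (a b c N N' : nat) (P : 'M[{poly F}]_(a, b)) (Q : 'M[{poly F}]_(b, c)) i j :
  (forall i j, (size (P i j) <= N)%N) -> (forall i j, (size (Q i j) <= N')%N) ->
  (size ((P *m Q) i j) <= N + N')%N.
Proof.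
move=> hP hQ; rewrite mxE; apply: size_sum_leq => k.
apply: leq_trans (size_polyMleq _ _) _.
by rewrite (leq_trans (leq_pred _)) // leq_add.
Qed.

Lemma sum_blocks (B n : nat) (p : {poly F}) : (0 < B)%N -> (size p <= B * n)%N ->
  p = \sum_(k < n) 'X^(B * k) * take_poly B (drop_poly (B * k) p).
Proof.
move=> B0 hp; apply/polyP => v.
rewrite (@coef_blocks _ B n (fun k => take_poly B (drop_poly (B * k) p))) //; last first.
  by move=> m; apply: size_take_poly.
rewrite coef_take_poly ltn_pmod // coef_drop_poly addnC [(B * _)%N]mulnC -divn_eq.
by case: ltnP => // hv; rewrite nth_default // (leq_trans hp) // mulnC -leq_divRL.
Qed.

(* The interpolation step: the inverse transform recovers [l ^ e.+1] times the
   product of two polynomials in [Y], modulo [cyclo l (l ^ e)]. *)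
Lemma mod_inverse_dft (l e a b c : nat) (f : nat -> 'M[{poly F}]_(a, b))
    (g : nat -> 'M[{poly F}]_(b, c)) (m : nat) :
  let L := (l ^ e.+1)%N in let Phi := cyclo F l (l ^ e) in
  prime l -> l%:R != 0 :> F -> (m < L)%N ->
  (forall k k', (L <= k + k')%N -> f k *m g k' = 0) ->
  mod_mx Phi (dft L L.-1 L
      (fun t => mod_mx ('X^L - 1) (dft L 1 L f t *m dft L 1 L g t)) m) =
  mod_mx Phi (L%:R *: \sum_(k < L) \sum_(k' < L | (k + k' == m)%N) f k *m g k').
Proof.
move=> L Phi lP l0 hm h0; set cc := fun m : nat =>
  \sum_(k < L) \sum_(k' < L | (k + k' == m)%N) f k *m g k'.
have PhiL : Phi %| 'X^L - 1 by rewrite /L expnSr -mul_cyclo dvdp_mulr.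
(* [Phi] divides ['X^L - 1], so modulo [Phi] the pointwise product of the transforms is the
   transform of the convolution [cc]. *)
have red_q t : mod_mx Phi (mod_mx ('X^L - 1) (dft L 1 L f t *m dft L 1 L g t)) =
    mod_mx Phi (\sum_(m' < L) ('X^t) ^+ m' *: cc m').
  rewrite mod_mx_dvd // -mod_mx_mul /dft !(mod_mx_dvd _ PhiL) mod_mx_mul.
  rewrite -mulmx_sum_powers //.
  by congr (mod_mx _ (_ *m _)); apply: eq_bigr => k _; rewrite mul1n exprM.
rewrite {1}/dft mod_mx_dvd // mod_mx_sum.
under eq_bigr => t _ do rewrite -mod_mx_scale red_q mod_mx_scale scaler_sumr.
rewrite -mod_mx_sum exchange_big /=.
have -> : \sum_(j < L) \sum_(i < L) 'X^(L.-1 * m * i) *: ('X^i ^+ j *: cc j) =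
    \sum_(j < L) (\sum_(i < L) 'X^((L.-1 * m + j) * i)) *: cc j.
  apply: eq_bigr => j _; rewrite scaler_suml; apply: eq_bigr => i _.
  by rewrite scalerA -exprM -exprD; congr ('X^_ *: _); ring.
(* By orthogonality only the summand [j = m] survives, with weight [L]. *)
rewrite mod_mx_sum (bigD1 (Ordinal hm)) //= [X in _ + X]big1 ?addr0 => [|j hj].
  rewrite -[RHS]/(mod_mx Phi (L%:R *: cc m)).
  by apply: mod_mx_scalel; have := sum_cyclic_roots lP l0 hm hm; rewrite eqxx.
have := sum_cyclic_roots lP l0 hm (ltn_ord j).
rewrite ifN; last by apply: contraNneq hj => h; apply/eqP/val_inj; rewrite /= -h.
move/mod_mx_scalel => ->; rewrite scale0r.
by apply/matrixP => i k; rewrite !mxE mod0p.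
Qed.

End PolyMatrixProduct.

(** * Recursive multiplication and its cost *)

Lemma pow16_growth (u v : nat) : (3 * u <= 2 * v)%N -> (162 * u ^ 16 <= v ^ 16)%N.
Proof.
(* The square of 3/2 exceeds 2, and the eighth power of 2 is 256, which exceeds 162. *)
move=> huv; have h : (2 * (u * u) <= v * v)%N by nia.
have e x : (x ^ 16 = (x * x) ^ 8)%N by rewrite mulnn -expnM.
rewrite !e; move: (u * u)%N (v * v)%N h => x y h.
apply: (@leq_trans ((2 * x) ^ 8)%N); last by rewrite leq_exp2r.
by rewrite expnMn leq_mul2r; apply/orP; right.
Qed.

Section PolyMatrixCost.
Variables (F : fieldType) (I : Type) (a b c Z : nat).
Implicit Types (cd s : seq (field_op * operand F I * operand F I)).
Hypothesis within_mulmx : forall cd (A : (I -> F) -> 'M[F]_(a, b)) (B : (I -> F) -> 'M[F]_(b, c)),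
  (forall i j, avail cd (fun x => A x i j)) ->
  (forall i j, avail cd (fun x => B x i j)) ->
  within Z cd (fun cd' => forall i j, avail cd' (fun x => (A x *m B x) i j)).

Lemma within_schoolbook N cd (P : (I -> F) -> 'M[{poly F}]_(a, b))
    (Q : (I -> F) -> 'M[{poly F}]_(b, c)) :
  deg_le N P -> deg_le N Q -> knows cd P -> knows cd Q ->
  within ((N + N) * (N + N) * (Z + a * c)) cd (fun cd' => knows cd' (fun x => P x *m Q x)).
Proof.
move=> dP dQ kP kQ.
pose A u x := map_mx (fun p : {poly F} => p`_u) (P x).
pose B u x := map_mx (fun p : {poly F} => p`_u) (Q x).
have step1 : within ((N + N) * (N + N) * Z) cd (fun cd' =>
    forall t : 'I_(N + N) * 'I_(N + N), forall i j,
      avail cd' (fun x => (A t.1 x *m B t.2 x) i j)).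
  have := @within_family F I ('I_(N + N) * 'I_(N + N))%type Z cd
    (fun t cd' => forall i j, avail cd' (fun x => (A t.1 x *m B t.2 x) i j)).
  rewrite card_prod !card_ord; apply=> [t cd' s h i j|t s]; first exact: avail_cat.
  by apply: within_mulmx => i j;
    [apply: avail_ext (avail_cat s (kP i j t.1))|apply: avail_ext (avail_cat s (kQ i j t.2))]
    => x; rewrite mxE.
rewrite mulnDr; apply: within_bind step1 _ => s hs.
(* Coefficient [u] of the product sums the pairs [(v, u - v)]; as [u] is below [N + N], so are both
   indices, which is why the products were formed over that range. *)
have -> : ((N + N) * (N + N) * (a * c) = a * c * (N + N) * (N + N))%N by ring.
apply: within_knows => [x i j|i j u s' hu]; first exact: size_mulmx.
apply: (within_le hu).
have := @within_sum F I u.+1 ((cd ++ s) ++ s') (fun v x => (A v x *m B (u - v)%N x) i j).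
move=> h; apply: within_imp (h _) => [s2|v hv].
  apply: avail_ext => x; rewrite mxE coef_sum.
  under [RHS]eq_bigr do rewrite coefM.
  rewrite exchange_big; apply: eq_bigr => v _; rewrite mxE.
  by apply: eq_bigr => k _; rewrite !mxE.
apply: avail_cat.
have hv' : (v < N + N)%N by lia.
have hu' : (u - v < N + N)%N by lia.
exact: (hs (Ordinal hv', Ordinal hu')).
Qed.

(** The operands are cut into [M = l ^ g.+1] blocks of length [B = l ^ g]. Since [L >= 2 * M], the
    transform of length [L] does not wrap around; since [2 * B <= M], the block products have degree
    below that of [cyclo l M] and are determined modulo it. The pointwise products are the [L]
    recursive calls. *)
Lemma within_fft_step (l g C : nat) cd (P : (I -> F) -> 'M[{poly F}]_(a, b))
    (Q : (I -> F) -> 'M[{poly F}]_(b, c)) :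
  let L := (l ^ g.+2)%N in prime l -> l%:R != 0 :> F ->
  (forall cd (P' : (I -> F) -> 'M[{poly F}]_(a, b)) (Q' : (I -> F) -> 'M[{poly F}]_(b, c)),
    deg_le L P' -> deg_le L Q' -> knows cd P' -> knows cd Q' ->
    within C cd (fun cd' => knows cd' (fun x => P' x *m Q' x))) ->
  deg_le (l ^ (g + g.+1)) P -> deg_le (l ^ (g + g.+1)) Q -> knows cd P -> knows cd Q ->
  within (L * C + 7 * g.+2 * l * (L * L) * (a * b + b * c + a * c)) cd
    (fun cd' => knows cd' (fun x => P x *m Q x)).
Proof.
move=> L lP l0 rec dP dQ kP kQ.
have lgt1 := prime_gt1 lP; have lgt0 := prime_gt0 lP.
pose B := (l ^ g)%N; pose M := (l ^ g.+1)%N.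
have B0 : (0 < B)%N by rewrite expn_gt0 lgt0.
have M0 : (0 < M)%N by rewrite expn_gt0 lgt0.
have L0 : (0 < L)%N by rewrite expn_gt0 lgt0.
have eM : M = (l * B)%N by rewrite /M expnS.
have eL : L = (l * M)%N by rewrite /L expnS.
have eBM : (l ^ (g + g.+1) = B * M)%N by rewrite expnD.
rewrite {}eBM in dP dQ.
have hML : (M + M <= L)%N by rewrite addnn -mul2n eL leq_mul2r lgt1 orbT.
have hBM : (B + B <= M)%N by rewrite addnn -mul2n eM leq_mul2r lgt1 orbT.
have L_neq0 : L%:R != 0 :> F by rewrite natrX expf_neq0.
pose blk a' b' (P' : (I -> F) -> 'M[{poly F}]_(a', b')) k x :=
  map_mx (fun p : {poly F} => take_poly B (drop_poly (B * k) p)) (P' x).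
have dblk a' b' (P' : (I -> F) -> 'M[{poly F}]_(a', b')) k : deg_le B (blk _ _ P' k).
  by move=> x i j; rewrite mxE size_take_poly.
have dblkL a' b' (P' : (I -> F) -> 'M[{poly F}]_(a', b')) k : deg_le L (blk _ _ P' k).
  by move=> x i j; apply: leq_trans (dblk _ _ _ _ _ _ _) _; lia.
have kblk a' b' (P' : (I -> F) -> 'M[{poly F}]_(a', b')) k cd' :
    knows cd' P' -> knows cd' (blk _ _ P' k).
  move=> kP' i j u; case: (ltnP u B) => hu.
    apply: avail_ext (kP' i j (u + B * k)%N) => x.
    by rewrite mxE coef_take_poly hu coef_drop_poly.
  by apply: avail_ext (avail_const _ 0) => x; rewrite mxE coef_take_poly ltnNge hu.
have blk0 a' b' (P' : (I -> F) -> 'M[{poly F}]_(a', b')) k x :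
    deg_le (B * M) P' -> (M <= k)%N -> blk _ _ P' k x = 0.
  move=> dP' hk; apply/matrixP => i j; rewrite !mxE drop_poly_eq0 ?take_poly0r //.
  by rewrite (leq_trans (dP' x i j)) // leq_mul2l hk orbT.
have blk_sum a' b' (P' : (I -> F) -> 'M[{poly F}]_(a', b')) x :
    deg_le (B * M) P' -> P' x = \sum_(k < L) ('X^B) ^+ k *: blk _ _ P' k x.
  move=> dP'; apply/matrixP => i j; rewrite summxE.
  rewrite {1}(@sum_blocks _ B L (P' x i j)) //; last first.
    by rewrite (leq_trans (dP' x i j)) // leq_mul2l; lia.
  by apply: eq_bigr => k _; rewrite !mxE exprM.
pose f := blk _ _ P; pose h := blk _ _ Q.
(* One of the two indices is at least [M], where the blocks are zero. *)
have fh0 x k k' : (L <= k + k')%N -> f k x *m h k' x = 0.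
  move=> hk; case: (leqP M k) => hMk; first by rewrite /f blk0 // mul0mx.
  by rewrite /h [blk _ _ Q k' x]blk0 ?mulmx0 //; lia.
pose cc m x := \sum_(k < L) \sum_(k' < L | (k + k' == m)%N) f k x *m h k' x.
have dcc m : deg_le (B + B) (cc m).
  move=> x i j; rewrite summxE; apply: size_sum_leq => k; rewrite summxE.
  rewrite big_mkcond; apply: size_sum_leq => k'; case: ifP => _; last by rewrite size_poly0.
  by apply: size_mulmx => ? ?; apply: dblk.
pose fhat t x := dft L 1 L (f^~ x) t; pose hhat t x := dft L 1 L (h^~ x) t.
pose q t x := mod_mx ('X^L - 1) (fhat t x *m hhat t x).
pose d m x := dft L L.-1 L (q^~ x) m.
(* The summands are, in order: the two forward transforms, the recursive products, their reduction
   modulo ['X^L - 1], the inverse transform, the recovery of the block products by a subtraction and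
   a scaling, and the addition of overlapping blocks. *)
apply: (@within_le _ _ (g.+2 * L * (a * b * L * l) + (g.+2 * L * (b * c * L * l)
  + (L * C + (L * (a * c * L * 1) + (g.+2 * L * (a * c * L * l)
  + (L * (a * c * (B + B) * 2) + a * c * (B * M + B * M) * 1))))))).
  have hBL : (B + B <= L)%N by lia.
  have hBML : (B * M + B * M <= L * L)%N.
    by rewrite -mulnDl leq_mul //; lia.
  have X1 : (L * (a * c * L * 1) <= a * c * (L * L))%N by apply: eq_leq; ring.
  have X2 : (L * (a * c * (B + B) * 2) <= a * c * (L * L) * 2)%N.
    apply: (@leq_trans (L * (a * c * L * 2))%N); last by apply: eq_leq; ring.
    by rewrite leq_mul2l leq_mul2r leq_mul2l hBL !orbT.
  have X3 : (a * c * (B * M + B * M) * 1 <= a * c * (L * L))%N.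
    by rewrite muln1 leq_mul2l hBML orbT.
  have X4 : (a * c * (L * L) <= g.+2 * l * (L * L) * (a * c))%N.
    by rewrite [(a * c * _)%N]mulnC leq_mul2r leq_pmull ?orbT // muln_gt0 lgt0.
  have E1 : (g.+2 * L * (a * b * L * l) = g.+2 * l * (L * L) * (a * b))%N by ring.
  have E2 : (g.+2 * L * (b * c * L * l) = g.+2 * l * (L * L) * (b * c))%N by ring.
  have E3 : (g.+2 * L * (a * c * L * l) = g.+2 * l * (L * L) * (a * c))%N by ring.
  have E4 : (7 * g.+2 * l * (L * L) * (a * b + b * c + a * c) =
     7 * (g.+2 * l * (L * L) * (a * b)) + 7 * (g.+2 * l * (L * L) * (b * c))
     + 7 * (g.+2 * l * (L * L) * (a * c)))%N by ring.
  rewrite E1 E2 E3 E4.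
  move: X1 X2 X3 X4.
  move: (L * C)%N (L * (a * c * L * 1))%N (L * (a * c * (B + B) * 2))%N
    (a * c * (B * M + B * M) * 1)%N (g.+2 * l * (L * L) * (a * c))%N
    (g.+2 * l * (L * L) * (b * c))%N (g.+2 * l * (L * L) * (a * b))%N
    (a * c * (L * L))%N.
  clear; move=> *; lia.
apply: within_bind (@within_dft F I L l g.+2 1 a b cd f L0 lgt0 _ _ _) _.
- by rewrite mul1n.
- by move=> k _; apply: dblkL.
- by move=> k _; apply: kblk.
move=> s1 k1.
apply: within_bind (@within_dft F I L l g.+2 1 b c _ h L0 lgt0 _ _ _) _.
- by rewrite mul1n.
- by move=> k _; apply: dblkL.
- by move=> k _; apply: kblk; apply: knows_cat.
move=> s2 k2.
apply: within_bind (@within_knows_family F I a c L C _ (fun t x => fhat t x *m hhat t x) _) _.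
  move=> t s _; apply: rec.
  - by move=> x i j; rewrite mxE size_mod_cyclic.
  - by move=> x i j; rewrite mxE size_mod_cyclic.
  - by do 2 apply: knows_cat; apply: k1.
  - by apply: knows_cat; apply: k2.
move=> s3 k3.
apply: within_bind (@within_knows_family F I a c L (a * c * L * 1) _ q _) _.
  move=> t s ht; apply: within_knows => [x i j|i j u s' hu].
    by rewrite mxE size_mod_cyclic.
  have kt := knows_cat s' (knows_cat s (k3 t ht)).
  apply: within_imp (within_op OpAdd (kt i j u) (kt i j (u + L)%N)) => s4.
  apply: avail_ext => x; rewrite [q t x i j]mxE coef_mod_cyclic ?hu //.
  by apply: size_mulmx => i' j'; rewrite mxE size_mod_cyclic.
move=> s4 k4.
apply: within_bind (@within_dft F I L l g.+2 L.-1 a c _ q L0 lgt0 _ _ _) _.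
- by rewrite dvdn_mull.
- by move=> k _ x i j; rewrite mxE size_mod_cyclic.
- by move=> k hk; apply: k4.
move=> s5 k5.
have MlE : (M * l.-1 + M = L)%N by rewrite eL -mulnSr prednK // mulnC.
apply: within_bind (@within_knows_family F I a c L (a * c * (B + B) * 2) _ cc _) _.
  move=> m s hm; apply: within_knows => [|i j u s' hu]; first exact: dcc.
  have km := knows_cat s' (knows_cat s (k5 m)).
  apply: (@within_bind _ _ 1 1 _ _ _ (within_op OpSub (km i j u)
     (km i j (u %% M + M * l.-1)%N))) => s6 hs6.
  apply: within_imp (within_op OpMul (avail_const _ (L%:R)^-1) hs6) => s7.
  apply: avail_ext => x.
  have : mod_mx (cyclo F l M) (d m x) = mod_mx (cyclo F l M) (L%:R *: cc m x).
    exact: (@mod_inverse_dft F l g.+1 a b c (f^~ x) (h^~ x) m lP l0 hm (fh0 x)).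
  move=> /matrixP/(_ i j); rewrite [LHS]mxE [RHS]mxE [(L%:R *: cc m x) i j]mxE => em.
  (* Equality of remainders is restated as a difference by a multiple of [cyclo F l M], the form in
     which the remainder can be read off. *)
  have [z ez] : exists z, d m x i j = L%:R * cc m x i j + cyclo F l M * z.
    exists (d m x i j %/ cyclo F l M - (L%:R * cc m x i j) %/ cyclo F l M).
    rewrite {1}(divp_eq (d m x i j) (cyclo F l M)) em.
    by rewrite {2}(divp_eq (L%:R * cc m x i j) (cyclo F l M)); ring.
  have hlB : (B + B <= M * l.-1)%N.
    by apply: leq_trans hBM _; rewrite leq_pmulr //; lia.
  have hu' : (u < M * l.-1)%N by apply: leq_trans hu hlB.
  have E : (L%:R * cc m x i j)`_u = (d m x i j)`_u - (d m x i j)`_(u %% M + M * l.-1)%N.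
    rewrite (coef_mod_cyclo u lgt0 M0 _ _ ez) ?hu' //.
      by rewrite mxE (leq_trans (size_mod_cyclic _ L0)) // mulnC -eL.
    rewrite mulr_natl -scaler_nat (leq_trans (size_scale_leq _ _)) //.
    exact: leq_trans (dcc _ _ _ _) hlB.
  by rewrite /= -E mulr_natl coefMn -[X in _ * X]mulr_natl mulKf.
move=> s6 k6.
have PQ x : P x *m Q x = \sum_(m < L) 'X^B ^+ m *: cc m x.
  rewrite (blk_sum _ _ P) // (blk_sum _ _ Q) //.
  exact: (@mulmx_sum_powers _ a b c L 'X^B (f^~ x) (h^~ x) (fh0 x)).
apply: within_knows => [x i j|i j u s hu]; first exact: size_mulmx.
have uL : (u %/ B < L)%N by rewrite ltn_divLR // (leq_trans hu) // -mulnDr mulnC leq_mul2r hML orbT.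
have kx m v : (m < L)%N -> avail (((((((cd ++ s1) ++ s2) ++ s3) ++ s4) ++ s5) ++ s6) ++ s)
   (fun x => (cc m x i j)`_v) by move=> hm; apply: avail_cat; apply: k6.
have eq_u x : ((P x *m Q x) i j)`_u = (cc (u %/ B)%N x i j)`_(u %% B)%N +
    (if (u %/ B)%N is m.+1 then (cc m x i j)`_(u %% B + B)%N else 0).
  rewrite PQ summxE.
  under eq_bigr => m _ do rewrite mxE -exprM.
  rewrite (@coef_overlap _ B L (fun m => cc m x i j)) //; last by move=> m; apply: dcc.
  by rewrite coef_take_poly ltn_pmod.
have k7 : avail (((((((cd ++ s1) ++ s2) ++ s3) ++ s4) ++ s5) ++ s6) ++ s)
   (fun x => if (u %/ B)%N is m.+1 then (cc m x i j)`_(u %% B + B)%N else 0).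
  case: (u %/ B)%N uL => [|m] hm; first exact: avail_const.
  by apply: kx; apply: ltnW.
apply: within_imp (within_op OpAdd (kx _ (u %% B)%N uL) k7) => s7.
by apply: avail_ext => x; rewrite eq_u.
Qed.

(* The exponent 16 absorbs a factor [162 = 2 * 3^4] per halving of [j], since rounding
   only lets [j + 1] shrink by [3 / 2] and [162 <= (3 / 2)^16]. *)
Lemma within_polymul (l j : nat) cd (P : (I -> F) -> 'M[{poly F}]_(a, b))
    (Q : (I -> F) -> 'M[{poly F}]_(b, c)) :
  prime l -> (l <= 3)%N -> l%:R != 0 :> F ->
  deg_le (l ^ (j + 4)) P -> deg_le (l ^ (j + 4)) Q -> knows cd P -> knows cd Q ->
  within (324 * l ^ (j + 4) * j.+1 ^ 16 * (Z + (a * b + b * c + a * c))) cd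
    (fun cd' => knows cd' (fun x => P x *m Q x)).
Proof.
move=> lP l3 l0; elim/ltn_ind: j cd P Q => -[|j] IH cd P Q dP dQ kP kQ.
  apply: within_le (within_schoolbook dP dQ kP kQ).
  rewrite add0n exp1n muln1; apply: leq_mul; last by rewrite leq_add2l leq_addl.
  have h81 : (l ^ 4 <= 81)%N by rewrite -[81%N]/(3 ^ 4)%N leq_exp2r.
  by move: (l ^ 4)%N h81 => N hN; nia.
have hl4 : (l ^ 4 <= 81)%N by rewrite -[81%N]/(3 ^ 4)%N leq_exp2r.
have lgt1 := prime_gt1 lP.
(* With [g = i.+2] the step covers length [l ^ (2 * i + 5)], enough because [2 * i >= j], and its
   recursive calls have length [l ^ (i + 4)], the instance [i] of the claim. *)
pose i := (j.+1)./2; set G := (Z + _)%N.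
have ij : (i < j.+1)%N by rewrite /i; lia.
have i3j : (3 * i.+1 <= 2 * j.+2)%N by rewrite /i; lia.
have step := @within_fft_step l i.+2 (324 * l ^ (i + 4) * i.+1 ^ 16 * G) cd P Q lP l0.
have e4 : (i.+2.+2 = i + 4)%N by lia.
rewrite e4 in step.
have le_pow : (l ^ (j.+1 + 4) <= l ^ (i.+2 + i.+3))%N by rewrite leq_exp2l // /i; lia.
have {}step := step (fun cd' P' Q' => IH i ij cd' P' Q').
have {step} := step _ _ kP kQ.
case=> [x i' j'|x i' j'|s hs hk].
- exact: leq_trans (dP x i' j') le_pow.
- exact: leq_trans (dQ x i' j') le_pow.
exists s => //; apply: leq_trans hs _.
set L := (l ^ (i + 4))%N; set X := (l ^ (j.+1 + 4))%N.
have LL : (L * L <= l ^ 4 * X)%N.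
  by rewrite -!expnD leq_exp2l // /i; lia.
(* The linear work is at most the recursive term, which doubles it; together with [l ^ 4 <= 81] this
   is the factor 162. *)
have key : (l ^ 4 * (324 * i.+1 ^ 16 + 7 * (i + 4) * l) <= 324 * j.+2 ^ 16)%N.
  have h1 : (7 * (i + 4) * l <= 324 * i.+1 ^ 16)%N.
    apply: (@leq_trans (324 * i.+1)%N); last first.
      by rewrite leq_mul2l -{1}(expn1 i.+1) leq_pexp2l.
    apply: (@leq_trans (7 * (i + 4) * 3)%N); first by rewrite leq_mul2l l3 orbT.
    lia.
  have h2 : (162 * i.+1 ^ 16 <= j.+2 ^ 16)%N.
    exact: pow16_growth.
  apply: (@leq_trans (81 * (324 * i.+1 ^ 16 + 324 * i.+1 ^ 16))%N).
    by apply: leq_mul => //; rewrite leq_add2l.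
  by move: h2; move: (i.+1 ^ 16)%N (j.+2 ^ 16)%N => u v; clear; lia.
have XG : (X * (l ^ 4 * (324 * i.+1 ^ 16 + 7 * (i + 4) * l)) * G <= 324 * X * j.+2 ^ 16 * G)%N.
  by rewrite leq_mul2r [(324 * X)%N]mulnC -(mulnA X) leq_mul2l key !orbT.
apply: leq_trans XG.
apply: (@leq_trans (L * L * (324 * i.+1 ^ 16 + 7 * (i + 4) * l) * G)%N).
  have -> : (L * L * (324 * i.+1 ^ 16 + 7 * (i + 4) * l) * G =
      L * (324 * L * i.+1 ^ 16 * G) + 7 * (i + 4) * l * (L * L) * G)%N.
    by move: (i.+1 ^ 16)%N => y; ring.
  by rewrite leq_add2l leq_mul2l leq_addl orbT.
by rewrite leq_mul2r; apply/orP; right; rewrite mulnA leq_mul2r [(X * _)%N]mulnC LL orbT.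
Qed.

End PolyMatrixCost.

(** * Lower bound for matrix multiplication *)

Definition operand_inputs (F I : Type) (a : operand F I) : seq I :=
  if a is Input i then [:: i] else [::].

Definition code_inputs (F I : Type) (cd : seq (field_op * operand F I * operand F I)) : seq I :=
  flatten [seq operand_inputs ins.1.2 ++ operand_inputs ins.2 | ins <- cd].

Lemma size_code_inputs (F I : Type) (cd : seq (field_op * operand F I * operand F I)) :
  (size (code_inputs cd) <= 2 * size cd)%N.
Proof.
elim: cd => [|[[o a] b] cd IH] //; rewrite /code_inputs /= size_cat mulnS.
by apply: leq_add IH; rewrite size_cat; case: a => [i|d|k]; case: b.
Qed.

Lemma run_unused (F : fieldType) (I : eqType) (z : I) (x y : I -> F) v cd :
  z \notin code_inputs cd -> (forall i, i != z -> x i = y i) ->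
  foldl (slp_step x) v cd = foldl (slp_step y) v cd.
Proof.
move=> hz hxy; elim: cd v hz => [|[[o a] b] cd IH] v //.
rewrite /code_inputs /= mem_cat negb_or mem_cat negb_or => /andP[/andP[ha hb] hcd].
have val_eq (t : operand F I) : z \notin operand_inputs t ->
    operand_val x v t = operand_val y v t.
  by case: t => //= i; rewrite inE eq_sym => /hxy.
by rewrite IH // !val_eq.
Qed.

Section LowerBound.
Variables (F : fieldType) (a b c : nat).
Variable p : slp F ('I_a * 'I_b + 'I_b * 'I_c) ('I_a * 'I_c).
Hypothesis hp : forall (A : 'M[F]_(a, b)) (B : 'M[F]_(b, c)),
  slp_eval p (join_inputs (entries A) (entries B)) =1 entries (A *m B).
Let size_code := size (slp_code p).

Lemma mul_delta i j k i' k' :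
  slp_eval p (join_inputs (entries (delta_mx i j)) (entries (delta_mx j k))) (i', k')
    = ((i' == i) && (k' == k))%:R.
Proof. by rewrite hp /entries mul_delta_mx mxE. Qed.

Lemma mul_zero (B : 'M[F]_(b, c)) o : slp_eval p (join_inputs (entries 0) (entries B)) o = 0.
Proof. by rewrite hp /entries mul0mx mxE. Qed.

(** An output cannot be an entry of a factor, since it vanishes when the other factor is zero; nor a
    constant or a missing result, since it takes both values 0 and 1. *)
Lemma mul_output (j : 'I_b) o :
  exists2 k, (k < size_code)%N & slp_out p o = Result k.
Proof.
case: o => i k; have := mul_zero (const_mx 1) (i, k); have := mul_delta i j k i k.
have : slp_eval p (join_inputs (entries (const_mx 1)) (entries 0)) (i, k) = 0.
  by rewrite hp /entries mulmx0 mxE.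
rewrite /slp_eval !eqxx; case: (slp_out p (i, k)) => [[z|z]|d|n] /=.
- by rewrite /entries mxE => /eqP; rewrite oner_eq0.
- by rewrite /entries !mxE => _ _ /eqP; rewrite oner_eq0.
- by move=> -> /esym/eqP; rewrite oner_eq0.
move=> _ h _; exists n => //; rewrite ltnNge; apply: contraTN isT => hn.
by move/eqP: h; rewrite nth_default ?size_run // eq_sym oner_eq0.
Qed.

(** If an entry were never read, clearing it in a product of two matrix units would leave the
    outputs unchanged, although the product drops from a matrix unit to zero. *)
Lemma mul_inputs_used z : (0 < a)%N -> (0 < c)%N -> z \in code_inputs (slp_code p).
Proof.
move=> a0 c0; apply: contraT => hz.
case: z hz => [[i j]|[j k]] hz.
  pose k := Ordinal c0; have [n hn eo] := mul_output j (i, k).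
  have := mul_zero (delta_mx j k) (i, k); have := mul_delta i j k i k.
  rewrite /slp_eval eo /= !eqxx.
  rewrite -(@run_unused F _ _ (join_inputs (entries 0) (entries (delta_mx j k)))
    (join_inputs (entries (delta_mx i j)) (entries (delta_mx j k))) [::] _ hz).
    by move=> -> /eqP; rewrite oner_eq0.
  case=> [[i' j']|] //= h; rewrite /entries !mxE /=; case: andP => // -[/eqP ei /eqP ej].
  by rewrite ei ej eqxx in h.
pose i := Ordinal a0; have [n hn eo] := mul_output j (i, k).
have : slp_eval p (join_inputs (entries (delta_mx i j)) (entries 0)) (i, k) = 0.
  by rewrite hp /entries mulmx0 mxE.
have := mul_delta i j k i k; rewrite /slp_eval eo /= !eqxx.
rewrite -(@run_unused F _ _ (join_inputs (entries (delta_mx i j)) (entries 0))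
  (join_inputs (entries (delta_mx i j)) (entries (delta_mx j k))) [::] _ hz).
  by move=> -> /eqP; rewrite oner_eq0.
case=> [//|[j' k']] h; rewrite /= /entries !mxE /=; case: andP => // -[/eqP ej /eqP ek].
by rewrite ej ek eqxx in h.
Qed.

(** An instruction reads at most two inputs, so the inputs number at most twice the cost; the
    outputs number at most the cost. *)
Lemma mulmx_cost_lower : (0 < a)%N -> (0 < b)%N -> (0 < c)%N ->
  (a * b + b * c + a * c <= 3 * slp_cost p)%N.
Proof.
move=> a0 b0 c0; rewrite (_ : 3 * slp_cost p = 2 * slp_cost p + slp_cost p)%N; last by lia.
apply: leq_add.
  have := @uniq_leq_size _ (enum {: 'I_a * 'I_b + 'I_b * 'I_c}) (code_inputs (slp_code p)).
  rewrite -cardE card_sum !card_prod !card_ord => h.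
  apply: leq_trans (h (enum_uniq _) _) (size_code_inputs _) => z _.
  exact: mul_inputs_used.
pose j := Ordinal b0.
have [r hr] : exists r : 'I_a * 'I_c -> 'I_size_code, forall o, slp_out p o = Result (r o).
  apply: (@fin_all_exists _ (fun=> 'I_size_code) (fun o k => slp_out p o = Result k)) => o.
  by have [k hk e] := mul_output j o; exists (Ordinal hk).
(* Outputs sharing an instruction would always agree, but a product that is a matrix unit separates
   them. *)
have rinj : injective r.
  move=> [i k] [i' k'] e; have := mul_delta i j k i' k'; have := mul_delta i j k i k.
  rewrite /slp_eval !hr e => -> /eqP; rewrite !eqxx.
  by case: (boolP ((i' == i) && _)) => [/andP[/eqP-> /eqP->] //|_]; rewrite oner_eq0.
by have := leq_card r rinj; rewrite card_prod !card_ord.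
Qed.

End LowerBound.

(** * Entries of the powers *)

Section PowerEntries.
Variables (F : fieldType) (n : nat) (S T : {set 'I_n}) (b H : nat).
Local Notation I := ('I_n * 'I_n + 'I_n * 'I_n + 'I_n * 'I_n + 'I_n * 'I_(2 * n - 1))%type.
Implicit Types x : I -> F.

(** Positions outside the matrix read 0, so the blocks may cover more than [n] indices. In the input
    type [inr] addresses [R], and [inl (inr _)] the inverse of [U]. *)
Definition window_entry (x : I -> F) (i : 'I_n) (l : nat) : F :=
  if insub l is Some l' then x (inr (i, l')) else 0.

Definition inverse_entry (x : I -> F) (l : nat) (j : 'I_n) : F :=
  if insub l is Some l' then x (inl (inr (l', j))) else 0.

(** For [l] in a block of length [H] and a shift below [H], the sum of the two ranges over [H + H]
    positions, so consecutive windows overlap. In [inverse_poly] each block is reversed, which turns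
    a correlation into a polynomial product. *)
Definition window_poly x : 'M[{poly F}]_(#|S|, b) :=
  \matrix_(i, q) \poly_(u < H + H) window_entry x (enum_val i) (H * q + u).

Definition inverse_poly x : 'M[{poly F}]_(b, #|T|) :=
  \matrix_(q, j) \poly_(r < H) inverse_entry x (H * q + (H - r.+1)) (enum_val j).

Lemma coef_window_inverse x i j k : (n <= H * b)%N -> (k < H)%N ->
  ((window_poly x *m inverse_poly x) i j)`_(H.-1 + k) =
  \sum_(l < n) window_entry x (enum_val i) (l + k) * inverse_entry x l (enum_val j).
Proof.
move=> hn hk; have H0 : (0 < H)%N by apply: leq_ltn_trans hk.
pose f l := window_entry x (enum_val i) (l + k) * inverse_entry x l (enum_val j).
have f0 l : (n <= l)%N -> f l = 0.
  by move=> hl; rewrite /f /inverse_entry insubN ?mulr0 // -leqNgt.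
have -> : \sum_(l < n) window_entry x (enum_val i) (l + k) * inverse_entry x l (enum_val j)
    = \sum_(l < H * b) f l.
  rewrite (big_ord_widen _ f hn) big_mkcond; apply: eq_bigr => l _.
  by case: ltnP => // /f0.
rewrite big_ord_mul exchange_big /= mxE coef_sum; apply: eq_bigr => q _.
rewrite !mxE coefMr.
have hle : (H <= (H.-1 + k).+1)%N by rewrite -addSn prednK // leq_addr.
(* In coefficient [H.-1 + k] the two positions always differ by [k]; reversing [r] then lists the
   block in its natural order. *)
pose h r := window_entry x (enum_val i) (H * q + (H.-1 + k - r)) *
  inverse_entry x (H * q + (H - r.+1)) (enum_val j).
transitivity (\sum_(r < H) h r).
  rewrite (big_ord_widen _ h hle) [RHS]big_mkcond; apply: eq_bigr => r _.
  rewrite !coef_poly; case: (ltnP r H) => hr; last by rewrite mulr0.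
  by rewrite ifT //; lia.
rewrite (reindex_inj rev_ord_inj); apply: eq_bigr => r _.
rewrite /h /f /=; have hr := ltn_ord r.
by congr (window_entry _ _ _ * inverse_entry _ _ _); lia.
Qed.

Lemma within_power_entries (l e Z : nat) :
  prime l -> (l <= 3)%N -> l%:R != 0 :> F -> (n <= H * b)%N -> (H + H <= l ^ (e + 4))%N ->
  (exists2 p : slp F ('I_#|S| * 'I_b + 'I_b * 'I_#|T|) ('I_#|S| * 'I_#|T|),
     slp_cost p = Z & forall A B,
     slp_eval p (join_inputs (entries A) (entries B)) =1 entries (A *m B)) ->
  forall h, (h <= H)%N ->
  exists2 p : slp F I ('I_h * 'I_#|S| * 'I_#|T|),
    (slp_cost p <= 324 * l ^ (e + 4) * e.+1 ^ 16 *
       (Z + (#|S| * b + b * #|T| + #|S| * #|T|)))%N &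
    forall x o, slp_eval p x o =
      \sum_(i < n) window_entry x (enum_val o.1.2) (i + o.1.1) *
        inverse_entry x i (enum_val o.2).
Proof.
move=> lP l3 l0 hn hH [mm hZ hmm] h hh; apply: slp_of_within.
have within_mm (cd : seq (field_op * operand F I * operand F I))
    (A : (I -> F) -> 'M[F]_(#|S|, b)) (B : (I -> F) -> 'M[F]_(b, #|T|)) :
    (forall i j, avail cd (fun x => A x i j)) -> (forall i j, avail cd (fun x => B x i j)) ->
    within Z cd (fun cd' => forall i j, avail cd' (fun x => (A x *m B x) i j)).
  move=> hA hB; rewrite -hZ.
  apply: within_imp (@within_subst F I _ _ mm cd
    (fun z x => join_inputs (entries (A x)) (entries (B x)) z) _).
    by move=> s hs i j; apply: avail_ext (hs (i, j)) => x; rewrite hmm.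
  by case=> [[i j]|[i j]]; [apply: hA | apply: hB].
have known_window : knows [::] window_poly.
  move=> i q u; case: (ltnP u (H + H)) => hu; last first.
    by apply: avail_ext (avail_const _ 0) => x; rewrite mxE coef_poly ltnNge hu.
  rewrite /window_poly /window_entry; case hl : (insub (H * q + u)%N : option 'I_(2 * n - 1)) => [l'|].
    apply: avail_ext (avail_input _ (inr (enum_val i, l'))) => x.
    by rewrite mxE coef_poly hu hl.
  by apply: avail_ext (avail_const _ 0) => x; rewrite mxE coef_poly hu hl.
have known_inverse : knows [::] inverse_poly.
  move=> q j u; case: (ltnP u H) => hu; last first.
    by apply: avail_ext (avail_const _ 0) => x; rewrite mxE coef_poly ltnNge hu.
  rewrite /inverse_poly /inverse_entry; case hl : (insub (H * q + (H - u.+1))%N : option 'I_n) => [l'|].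
    apply: avail_ext (avail_input _ (inl (inr (l', enum_val j)))) => x.
    by rewrite mxE coef_poly hu hl.
  by apply: avail_ext (avail_const _ 0) => x; rewrite mxE coef_poly hu hl.
apply: within_imp (within_polymul within_mm (j := e) lP l3 l0 _ _ known_window known_inverse).
- move=> s hs [[k i] j]; apply: avail_ext (hs i j (H.-1 + k)%N) => x.
  by rewrite coef_window_inverse // (leq_trans (ltn_ord k)).
- by move=> x i j; rewrite mxE (leq_trans (size_poly _ _)).
- move=> x i j; rewrite mxE (leq_trans (size_poly _ _)) //.
  by apply: leq_trans hH; apply: leq_addr.
Qed.

End PowerEntries.

(** * Powers through the Frobenius form *)

Lemma frobenius_power_entry (F : fieldType) (m : nat) (A U C : 'M[F]_m.+1)
    (R : 'M[F]_(m.+1, 2 * m.+1 - 1)) (k i j : 'I_m.+1) :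
  U \in unitmx -> A = U *m C *m invmx U -> U *m C ^+ k.+1 = window R k ->
  (A ^+ k.+1) i j = \sum_(l < m.+1) R i (Ordinal (window_subproof k l)) * invmx U l j.
Proof.
move=> hU hA hR; have -> : A ^+ k.+1 = window R k *m invmx U.
  rewrite -hR; elim: k.+1 => [|r IH]; first by rewrite !expr0 mulmx1 mulmxV.
  rewrite exprSr IH hA exprSr -!mulmxE -!mulmxA (mulmxA (invmx U) U).
  by rewrite mulVmx // mul1mx.
by rewrite mxE; apply: eq_bigr => l _; rewrite mxE.
Qed.

Lemma power_entry_inputs (F : fieldType) (m : nat) (A U C : 'M[F]_m.+1)
    (R : 'M[F]_(m.+1, 2 * m.+1 - 1)) (k i j : 'I_m.+1) :
  U \in unitmx -> A = U *m C *m invmx U -> U *m C ^+ k.+1 = window R k ->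
  let x := join_inputs (join_inputs (join_inputs
     (entries U) (entries C)) (entries (invmx U))) (entries R) in
  \sum_(l < m.+1) window_entry x i (l + k) * inverse_entry x l j = (A ^+ k.+1) i j.
Proof.
move=> hU hA hR x; rewrite (frobenius_power_entry _ _ hU hA hR).
apply: eq_bigr => l _; congr (_ * _); last by rewrite /inverse_entry valK.
have hlk : (l + k < 2 * m.+1 - 1)%N by rewrite addnC window_subproof.
rewrite /window_entry insubT /x /= /entries /=.
by congr (R _ _); apply: val_inj; rewrite /= addnC.
Qed.

(** * Estimates for rounded powers and logarithms *)

Lemma floor_pow_ge1 (K : realType) (n : nat) (r : K) :
  (0 < n)%N -> 0 <= r -> (0 < floor_pow n r)%N.
Proof.
move=> n0 r0; rewrite truncn_gt0 -[leLHS](powRr0 n%:R).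
by apply: ler_powR => //; rewrite ler1n.
Qed.

Lemma floor_pow_le (K : realType) (n : nat) (r : K) : (floor_pow n r)%:R <= n%:R `^ r.
Proof. by rewrite truncn_le powR_ge0. Qed.

Lemma floor_pow_leq (K : realType) (n : nat) (r : K) :
  (0 < n)%N -> r <= 1 -> (floor_pow n r <= n)%N.
Proof.
move=> n0 r1; rewrite -(ler_nat K) (le_trans (floor_pow_le _ _)) //.
by rewrite ler1_powR // ler1n.
Qed.

(** A real number that is at least 1 is at most twice its floor; two roundings give the factor 4,
    hence blocks of length [4 * h]. *)
Lemma leq_floor_pow_compl (K : realType) (n : nat) (r : K) : (0 < n)%N -> 0 <= r <= 1 ->
  (n <= 4 * floor_pow n r * floor_pow n (1 - r))%N.
Proof.
move=> n0 /andP[r0 r1].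
have n1 : (1 : K) <= n%:R by rewrite ler1n.
have le2 (u : K) : 0 <= u -> n%:R `^ u <= 2 * (floor_pow n u)%:R.
  move=> u0; apply: (le_trans (ltW (truncnS_gt _))).
  have := floor_pow_ge1 n0 u0; rewrite -/(floor_pow n u) -natrM ler_nat; lia.
rewrite -(ler_nat K) !natrM.
have {1}-> : (n%:R : K) = n%:R `^ r * n%:R `^ (1 - r).
  rewrite -powRD ?subrKC ?powRr1 ?ler0n //.
  by apply/implyP => _; rewrite pnatr_eq0 -lt0n.
rewrite (_ : 4 * _ * _ = (2 * (floor_pow n r)%:R) * (2 * (floor_pow n (1 - r))%:R));
  last by ring.
by apply: ler_pM; rewrite ?powR_ge0 ?le2 // subr_ge0.
Qed.

Lemma up_log_bound (K : realType) (l h n : nat) : (1 < l)%N -> (0 < h)%N -> (h <= n)%N ->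
  (up_log l (8 * h)).+1%:R <= (5 + (ln (2 : K))^-1) * (1 + ln n%:R).
Proof.
move=> l1 h0 hn; set e := up_log l _.
have n0 : (0 < n)%N by apply: leq_trans hn.
have ln2 : 0 < ln (2 : K) by rewrite ln_gt0 // ltr1n.
have lnn : 0 <= ln (n%:R : K) by rewrite ln_ge0 // ler1n.
have hpow : (2 ^ e.-1 <= 2 ^ 3 * n)%N.
  have h1 : (2 ^ e.-1 <= l ^ e.-1)%N by case: (e.-1) => // k; rewrite leq_exp2r.
  apply: leq_trans h1 (leq_trans (ltnW (up_log_gtn l1 _)) _); first by lia.
  by rewrite leq_mul2l hn orbT.
have hln : e.-1%:R * ln (2 : K) <= 3 * ln 2 + ln n%:R.
  have natX k : k%:R * ln (2 : K) = ln (2 ^+ k) by rewrite lnXn // mulr_natl.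
  rewrite natX (natX 3) -lnM ?posrE ?exprn_gt0 ?ltr0n // ler_ln ?posrE ?mulr_gt0 ?exprn_gt0 ?ltr0n //.
  by rewrite -!natrX -natrM ler_nat.
(* The constant 5 is this 2 plus the 3 coming from the base-2 logarithm of 8. *)
have he : (e.+1%:R : K) <= e.-1%:R + 2 by rewrite -natrD ler_nat; lia.
have hq : (e.-1%:R : K) <= 3 + (ln 2)^-1 * ln n%:R.
  have -> : (3 + (ln 2)^-1 * ln n%:R : K) = (3 * ln 2 + ln n%:R) / ln 2.
    by field; rewrite gt_eqF.
  by rewrite ler_pdivlMr.
have iln : 0 <= (ln (2 : K))^-1 by rewrite invr_ge0 ltW.
by nra.
Qed.

(** The upper bound combines [l ^ 4 <= 81] with rounding [8 * h] up to a power of [l], which loses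
    at most a factor [l <= 3]. *)
Lemma transform_length (l h : nat) : (1 < l)%N -> (l <= 3)%N -> (0 < h)%N ->
  (4 * h + 4 * h <= l ^ (up_log l (8 * h) + 4) <= 81 * 24 * h)%N.
Proof.
move=> l1 l3 h0; set e := up_log l (8 * h); apply/andP; split.
  apply: (@leq_trans (l ^ e)); last by rewrite leq_exp2l // leq_addr.
  by apply: leq_trans (up_logP _ l1); rewrite -mulnDl.
have h1 : (l ^ e.-1 < 8 * h)%N by apply: up_log_gtn => //; lia.
have h2 : (l ^ e <= 3 * l ^ e.-1)%N.
  apply: (@leq_trans (l ^ e.-1.+1)); first by rewrite leq_exp2l // leqSpred.
  by rewrite expnS leq_mul2r l3 orbT.
have h3 : (l ^ 4 <= 81)%N by rewrite -[81%N]/(3 ^ 4)%N leq_exp2r.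
rewrite expnD mulnC -mulnA; apply: leq_mul => //.
by move: (l ^ e)%N (l ^ e.-1)%N h1 h2 => u v; clear; lia.
Qed.

Theorem theorem9 (K : realType) (F : finFieldType) (alpha s t w : K)
    (alpha01 : 0 <= alpha <= 1) (s01 : 0 <= s <= 1) (t01 : 0 <= t <= 1)
    (mm_w : mm_exponent F s (1 - alpha) t w) :
  exists (c : K) (d : nat), forall (m : nat), let n := m.+1 in
  forall (S T : {set 'I_n}), let h := floor_pow n alpha in
    #|S| = floor_pow n s -> #|T| = floor_pow n t ->
    exists p : slp F
        ('I_n * 'I_n + 'I_n * 'I_n + 'I_n * 'I_n + 'I_n * 'I_(2 * n - 1))
        ('I_h * 'I_#|S| * 'I_#|T|),
      (slp_cost p)%:R <= c * n%:R `^ (w + alpha) * (1 + ln n%:R) ^+ d /\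
      forall (A U C : 'M[F]_n) (R : 'M[F]_(n, 2 * n - 1)),
        generic_mx A -> frobenius_form A U C ->
        (forall k : 'I_n, U *m C ^+ k.+1 = window R k) ->
        forall (k : 'I_h) (i : 'I_#|S|) (j : 'I_#|T|),
          slp_eval p
            (join_inputs (join_inputs (join_inputs
              (entries U) (entries C)) (entries (invmx U))) (entries R))
            (k, i, j)
          = submx_of S T (A ^+ k.+1) i j.
Proof.
case: mm_w => C0 mm.
have [l [lP l3 l0]] : exists l, [/\ prime l, (l <= 3)%N & l%:R != 0 :> F].
  have [h2|h2] := eqVneq (2%:R : F) 0; last by exists 2%N.
  by exists 3%N; split => //; rewrite -[3%N]/(2 + 1)%N natrD h2 add0r oner_neq0.
(* The factors come from [within_polymul], from the transform length, from absorbing the additions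
   into the products (1 + 3), and from the logarithmic bound raised to the power 16. *)
exists (324 * (81 * 24) * 4 * (5 + (ln (2 : K))^-1) ^+ 16 * C0), 16%N => m n S T h hS hT.
have /andP[a0 a1] := alpha01; have /andP[s0 _] := s01; have /andP[t0 _] := t01.
set b := floor_pow n (1 - alpha).
have h0 : (0 < h)%N by apply: floor_pow_ge1.
have b0 : (0 < b)%N by apply: floor_pow_ge1; rewrite ?subr_ge0.
have S0 : (0 < #|S|)%N by rewrite hS floor_pow_ge1.
have T0 : (0 < #|T|)%N by rewrite hT floor_pow_ge1.
have [mmp [mm_cost mmE]] : exists p : slp F ('I_#|S| * 'I_b + 'I_b * 'I_#|T|) ('I_#|S| * 'I_#|T|),
    (slp_cost p)%:R <= C0 * n%:R `^ w /\ forall A B,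
    slp_eval p (join_inputs (entries A) (entries B)) =1 entries (A *m B).
  by rewrite hS hT; apply: mm.
(* This absorbs the additions: the three matrix areas together are at most three times the cost of
   one product. *)
have lower := mulmx_cost_lower mmE S0 b0 T0.
have hn : (h <= n)%N by apply: floor_pow_leq.
pose e := up_log l (8 * h).
have l1 := prime_gt1 lP.
have /andP[size_H pow_e] := transform_length l1 l3 h0; rewrite -/e in size_H pow_e.
have cover : (n <= 4 * h * b)%N by apply: leq_floor_pow_compl.
have hH : (h <= 4 * h)%N by rewrite leq_pmull.
have [p hp pE] := @within_power_entries F n S T b (4 * h) l e _ lP l3 l0 cover size_H
  (ex_intro2 _ _ mmp erefl mmE) h hH.
exists p; split.
  have hp' : (slp_cost p <= 324 * (81 * 24 * h) * e.+1 ^ 16 * (4 * slp_cost mmp))%N.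
    apply: leq_trans hp _; apply: leq_mul; last by rewrite mulSn leq_add2l.
    by rewrite leq_mul2r leq_mul2l pow_e !orbT.
  rewrite -(ler_nat K) in hp'; apply: le_trans hp' _.
  rewrite natrM [(324 * _ * _)%:R]natrM [(324 * _)%:R]natrM [(81 * 24 * h)%:R]natrM
    [(4 * _)%:R]natrM natrX natrM.
  have he := up_log_bound K l1 h0 hn.
  have hh : (h%:R : K) <= n%:R `^ alpha := floor_pow_le _ _.
  rewrite powRD; last by apply/implyP => _; rewrite pnatr_eq0.
  rewrite [leLHS](_ : _ = 324 * (81 * 24) * 4 *
    (h%:R * (e.+1%:R ^+ 16 * (slp_cost mmp)%:R))); last by ring.
  set c3 := 5 + _ in he *; set L := 1 + ln _ in he *.
  rewrite [leRHS](_ : _ = 324 * (81 * 24) * 4 *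
    (n%:R `^ alpha * ((c3 * L) ^+ 16 * (C0 * n%:R `^ w)))); last by ring.
  rewrite ler_pM2l; last by rewrite !mulr_gt0 ?ltr0n.
  apply: ler_pM; rewrite ?ler0n ?mulr_ge0 ?exprn_ge0 ?ler0n //.
  apply: ler_pM; rewrite ?ler0n ?exprn_ge0 ?ler0n //.
  by rewrite lerXn2r // nnegrE ?ler0n // (le_trans _ he) ?ler0n.
move=> A U C R _ [hU _ hA] hR k i j; rewrite pE /= mxE.
have hk : (k < n)%N by apply: leq_trans (ltn_ord k) hn.
exact: (power_entry_inputs (k := Ordinal hk) _ _ hU hA (hR (Ordinal hk))).
Qed.
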